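(* Let $A$ be an integral domain and $\star$ a finite type star operation on $A$. Then the following conditions are equivalent. (i) $A$ has the $\star$-finite character. (ii) For each nonzero element $a\in A$, every $\star$-comaximal collection over $a$ of proper $\star$-finite $\star$-ideals of $A$ is finite.
   Context: Let $A$ be an integral domain with quotient field $K$. ''Ideal'' means integral ideal. A star operation on $A$ is a map $I\mapsto I^\star$ from the set $F(A)$ of nonzero fractional ideals of $A$ to itself such that for all $I,J\in F(A)$ and $0\ne x\in K$: $A^\star=A$, $(xI)^\star=xI^\star$; $I\subseteq J\Rightarrow I^\star\subseteq J^\star$; $(I^\star)^\star=I^\star$. It is of finite type if $I^\star=\bigcup\{J^\star: J\subseteq I,\ J\in F(A) \text{ finitely generated}\}$ for all $I\in F(A)$. $I\in F(A)$ is a $\star$-ideal if $I^\star=I$; $I$ is $\star$-finite if there is a finitely generated $J\in F(A)$ with $J^\star=I^\star$. For $\star$ of finite type, a $\star$-maximal ideal is a maximal element of the set of proper integral $\star$-ideals; such ideals are prime and every proper $\star$-ideal is contained in one. $A$ has the $\star$-finite character if each nonzero element of $A$ is contained in only finitely many $\star$-maximal ideals. For $0\ne a\in A$, a set $\mathscr F$ of ideals of $A$ is a $\star$-comaximal collection over $a$ if $a$ belongs to every member of $\mathscr F$ and $(\mathfrak a_1+\mathfrak a_2)^\star=A$ for all distinct $\mathfrak a_1,\mathfrak a_2\in\mathscr F$. *)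

(* Defs.v *)
From mathcomp Require Import all_boot all_order all_algebra.
From mathcomp Require Import all_classical.

Set Implicit Arguments.
Unset Strict Implicit.
Unset Printing Implicit Defensive.

Import GRing.Theory.
Local Open Scope classical_set_scope.
Local Open Scope ring_scope.

(* A is identified with its image in its quotient field K = {fraction A}; in
   particular an ideal of A is a subset of K contained in that image. *)

Section StarOperations.
Variable A : idomainType.
Local Notation K := {fraction A}.
Implicit Types (I J : set K) (star : set K -> set K).

Definition base_ring : set K := range (@tofrac A).

Definition submodule I : Prop :=
  [/\ I 0,
      (forall x y, I x -> I y -> I (x + y)) &
      (forall (r : A) x, I x -> I (tofrac r * x))].

Definition integral_ideal I : Prop := submodule I /\ I `<=` base_ring.

Definition proper_integral_ideal I : Prop := integral_ideal I /\ I <> base_ring.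

(* F(A), the nonzero fractional ideals *)
Definition fractional_ideal : set (set K) :=
  [set I | [/\ submodule I,
               (exists2 x, I x & x != 0) &
               (exists2 d : A, d != 0 &
                  forall x, I x -> base_ring (tofrac d * x))]].

Definition finitely_generated I : Prop :=
  exists n (g : 'I_n -> K),
    I = [set x | exists c : 'I_n -> A, x = \sum_i tofrac (c i) * g i].

Definition scale_ideal (x : K) I : set K := [set x * y | y in I].

Definition add_ideal I J : set K := [set x + y | x in I & y in J].

(* A map F(A) -> F(A) is a total map on subsets of K that sends F(A) into
   F(A); its values outside F(A) are unconstrained and never used. *)
Record star_operation star : Prop := StarOperation {
  star_fractional : forall I, fractional_ideal I -> fractional_ideal (star I);
  star_base : star base_ring = base_ring;
  star_scale : forall I (x : K), fractional_ideal I -> x != 0 ->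
    star (scale_ideal x I) = scale_ideal x (star I);
  star_mono : forall I J, fractional_ideal I -> fractional_ideal J ->
    I `<=` J -> star I `<=` star J;
  star_idem : forall I, fractional_ideal I -> star (star I) = star I }.

Definition finite_type star : Prop :=
  forall I, fractional_ideal I ->
    star I = \bigcup_(J in [set J | [/\ J `<=` I, fractional_ideal J &
                                        finitely_generated J]]) star J.

Definition star_ideal star I : Prop := fractional_ideal I /\ star I = I.

Definition star_finite star I : Prop :=
  fractional_ideal I /\
  exists J, [/\ fractional_ideal J, finitely_generated J & star J = star I].

Definition star_maximal star I : Prop :=
  [/\ proper_integral_ideal I, star_ideal star I &
      forall J, proper_integral_ideal J -> star_ideal star J -> I `<=` J -> J = I].

Definition star_finite_character star : Prop :=
  forall a : A, a != 0 ->
    finite_set [set M | star_maximal star M /\ M (tofrac a)].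

Definition star_comaximal_collection star (a : A) (F : set (set K)) : Prop :=
  [/\ (forall I, F I -> integral_ideal I),
      (forall I, F I -> I (tofrac a)) &
      (forall I J, F I -> F J -> I <> J ->
         star (add_ideal I J) = base_ring)].

End StarOperations.

(* Main.v *)
(* Infinitely many star-maximal ideals over a would force an infinite comaximal
   collection.  Call a star-maximal M over a isolated if some finite set
   containing a lies in M and in no other star-maximal ideal: finite sets
   isolating distinct ideals generate star-comaximal ideals, so only finitely
   many M are isolated.  If M is not isolated, adjoin to a an element of M
   outside each isolated ideal; no finite set containing the result isolates
   anything, so it can be split repeatedly into star-comaximal halves. *)

Require Import Defs.
From mathcomp Require Import all_boot all_order all_algebra.
From mathcomp Require Import all_classical.

Set Implicit Arguments.
Unset Strict Implicit.
Unset Printing Implicit Defensive.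

Local Open Scope classical_set_scope.
Local Open Scope ring_scope.

Import GRing.Theory.

(** * Finite sets and chains of sets *)

Lemma finite_set_inj {T U : Type} (f : T -> U) (D : set T) :
  (forall x y, D x -> D y -> f x = f y -> x = y) ->
  finite_set (f @` D) -> finite_set D.
Proof.
move=> f_inj; rewrite (eq_finite_set (B := D)) //; apply: inj_card_eq.
by move=> x y; rewrite !inE; exact: f_inj.
Qed.

(** Of two members of a chain the larger contains both, so one absorbs the elements of [s] one at a
    time; [X0] serves the empty sequence. *)
Lemma chain_seq_sub {T : eqType} (F : set (set T)) (X0 : set T) (s : seq T) :
  F X0 -> total_on F subset -> [set` s] `<=` \bigcup_(X in F) X ->
  exists2 X, F X & [set` s] `<=` X.
Proof.
move=> FX0 totF; elim: s => [|x s IHs] sF; first by exists X0.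
have [y ys|X FX sX] := IHs; first by apply: sF; rewrite /= inE ys orbT.
have [|Y FY Yx] := sF x; first by rewrite /= mem_head.
have [XY|YX] := totF _ _ FX FY.
  by exists Y => // y /=; rewrite inE => /predU1P[->//|/sX/XY].
by exists X => // y /=; rewrite inE => /predU1P[->|/sX//]; exact: YX.
Qed.

(** * Integral ideals, their sums, and spans of finite sequences *)

Section IntegralIdeals.
Context {A : idomainType}.
Local Notation K := {fraction A}.
Implicit Types (I J : set K) (s t : seq K).

Lemma submodule_sum {I} {n : nat} (c : 'I_n -> A) (g : 'I_n -> K) :
  submodule I -> (forall i, I (g i)) -> I (\sum_i tofrac (c i) * g i).
Proof.
by case=> I0 ID IM Ig; apply: (big_ind I) => // i _; exact: IM.
Qed.

Lemma combinations_submodule {n : nat} (g : 'I_n -> K) :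
  submodule [set x | exists c : 'I_n -> A, x = \sum_i tofrac (c i) * g i].
Proof.
split.
- by exists (fun=> 0); rewrite big1// => i _; rewrite tofrac0 mul0r.
- move=> _ _ [c ->] [d ->]; exists (fun i => c i + d i).
  by rewrite -big_split; apply: eq_bigr => i _; rewrite tofracD mulrDl.
- move=> r _ [c ->]; exists (fun i => r * c i).
  by rewrite mulr_sumr; apply: eq_bigr => i _; rewrite tofracM mulrA.
Qed.

Lemma integral_ideal_full I :
  integral_ideal I -> I 1 -> I = base_ring (A := A).
Proof.
move=> [[_ _ IM] IA] I1; apply/seteqP; split=> // _ [r _ <-].
by rewrite -[tofrac r]mulr1; exact: IM.
Qed.

Lemma base_ring_integral : integral_ideal (base_ring (A := A)).
Proof.
split=> //; split=> [|_ _ [x _ <-] [y _ <-]|r _ [x _ <-]].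
- by exists 0 => //; rewrite tofrac0.
- by exists (x + y) => //; rewrite tofracD.
- by exists (r * x) => //; rewrite tofracM.
Qed.

Lemma integral_fractional {I} (x : K) :
  integral_ideal I -> I x -> x != 0 -> fractional_ideal I.
Proof.
move=> [subI IA] Ix x0; split=> //; first by exists x.
by exists 1; rewrite ?oner_neq0// => y Iy; rewrite tofrac1 mul1r; exact: IA.
Qed.

Lemma base_ring_fractional : fractional_ideal (base_ring (A := A)).
Proof.
apply: (@integral_fractional _ 1) base_ring_integral _ _; last exact: oner_neq0.
by exists 1 => //; rewrite tofrac1.
Qed.

Lemma add_idealL I J : submodule J -> I `<=` add_ideal I J.
Proof. by move=> [J0 _ _] x Ix; exists x => //; exists 0; rewrite ?addr0. Qed.

Lemma add_idealR I J : submodule I -> J `<=` add_ideal I J.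
Proof. by move=> [I0 _ _] x Jx; exists 0 => //; exists x; rewrite ?add0r. Qed.

Lemma add_ideal_sub I J N :
  submodule N -> I `<=` N -> J `<=` N -> add_ideal I J `<=` N.
Proof.
by move=> [_ ND _] IN JN _ [x Ix [y Jy <-]]; apply: ND; [exact: IN|exact: JN].
Qed.

Lemma add_ideal_integral I J :
  integral_ideal I -> integral_ideal J -> integral_ideal (add_ideal I J).
Proof.
move=> [[I0 ID IM] IA] [[J0 JD JM] JA]; split; last first.
  by apply: add_ideal_sub => //; case: base_ring_integral.
split.
- by exists 0 => //; exists 0; rewrite ?addr0.
- move=> _ _ [x Ix [y Jy <-]] [z Iz [w Jw <-]].
  exists (x + z); first exact: ID.
  by exists (y + w); [exact: JD|rewrite addrACA].
- move=> r _ [x Ix [y Jy <-]].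
  exists (tofrac r * x); first exact: IM.
  by exists (tofrac r * y); [exact: JM|rewrite mulrDr].
Qed.

(** Taken as an intersection of submodules, so that inclusions into a submodule are checked on
    generators; [seq_span_fg] recovers the linear combinations. *)
Definition seq_span s : set K :=
  [set x | forall I, submodule I -> [set` s] `<=` I -> I x].

Lemma seq_span_submodule s : submodule (seq_span s).
Proof.
split=> [I [] //|x y sx sy I subI sI|r x sx I subI sI].
- by have [_ ID _] := subI; apply: ID; [exact: sx|exact: sy].
- by have [_ _ IM] := subI; apply: IM; exact: sx.
Qed.

Lemma seq_span_gen s : [set` s] `<=` seq_span s.
Proof. by move=> x sx I _; apply. Qed.

Lemma seq_span_sub s I : submodule I -> [set` s] `<=` I -> seq_span s `<=` I.
Proof. by move=> subI sI x; apply. Qed.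

Lemma seq_span_fg s : finitely_generated (seq_span s).
Proof.
exists (size s), (fun i => s`_i); apply/seteqP; split; last first.
  move=> _ [c ->]; apply: submodule_sum; first exact: seq_span_submodule.
  by move=> i; apply: seq_span_gen; rewrite /= mem_nth.
apply: seq_span_sub (combinations_submodule _) _.
move=> x /= xs; have ltxs : (index x s < size s)%N by rewrite index_mem.
exists (fun i => (i == Ordinal ltxs)%:R).
rewrite (bigD1 (Ordinal ltxs))//= eqxx tofrac1 mul1r nth_index// big1 ?addr0//.
by move=> i /negPf->; rewrite tofrac0 mul0r.
Qed.

Lemma fg_seq_span I : finitely_generated I -> exists s, I = seq_span s.
Proof.
move=> [n [g ->]]; exists [seq g i | i <- enum 'I_n]; apply/seteqP; split.
  move=> _ [c ->]; apply: submodule_sum; first exact: seq_span_submodule.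
  by move=> i; apply: seq_span_gen; rewrite /= map_f// mem_enum.
apply: seq_span_sub (combinations_submodule _) _.
move=> x /= /mapP[j _ ->]; exists (fun i => (i == j)%:R).
rewrite (bigD1 j)//= eqxx tofrac1 mul1r big1 ?addr0//.
by move=> i /negPf->; rewrite tofrac0 mul0r.
Qed.

(** Each element of [s] is split as [p + q], and the two kinds of summands are collected in [u] and
    [v]. The last clause ranges over all submodules so that it can be applied to star-maximal
    ideals. *)
Lemma add_ideal_seq I J s :
  [set` s] `<=` add_ideal I J ->
  exists u v, [/\ [set` u] `<=` I, [set` v] `<=` J &
    forall N, submodule N -> [set` u ++ v] `<=` N -> [set` s] `<=` N].
Proof.
elim: s => [|x s IHs] sIJ; first by exists [::], [::].
have [y ys|u [v [uI vJ uvs]]] := IHs; first by apply: sIJ; rewrite /= inE ys orbT.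
have [|p Ip [q Jq xE]] := sIJ x; first by rewrite /= mem_head.
exists (p :: u), (q :: v); split.
- by move=> y /=; rewrite inE => /predU1P[->//|/uI].
- by move=> y /=; rewrite inE => /predU1P[->//|/vJ].
- move=> N subN uvN y /=; rewrite inE => /predU1P[->|ys].
    have [_ ND _] := subN; rewrite -xE; apply: ND; apply: uvN => /=.
      by rewrite mem_head.
    by rewrite inE mem_cat mem_head !orbT.
  apply: uvs ys => // z /= zuv; apply: uvN; rewrite /= inE mem_cat inE.
  by move: zuv; rewrite mem_cat => /orP[]->; rewrite !orbT.
Qed.

End IntegralIdeals.

(** * Star-maximal ideals for a star operation of finite type *)

Section StarMaximal.
Context {A : idomainType} {star : set {fraction A} -> set {fraction A}}.
Hypotheses (star_op : star_operation star) (star_ft : finite_type star).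
Local Notation K := {fraction A}.
Local Notation R := (base_ring (A := A)).
Implicit Types (I J M N : set K) (s t : seq K).

(* For 0 != x in I, monotonicity applied to xA <= I gives x in (xA)^* = xA^* = xA <= I^*. *)
Lemma sub_star I : fractional_ideal I -> I `<=` star I.
Proof.
move=> fI x Ix; have [[I0 ID IM] _ [d d0 dI]] := fI.
have [->|x0] := eqVneq x 0.
  by have [[]] := star_fractional star_op fI.
have xR : scale_ideal x R x.
  by exists 1; [exists 1 => //; rewrite tofrac1|rewrite mulr1].
have xRI : scale_ideal x R `<=` I.
  by move=> _ [_ [r _ <-] <-]; rewrite mulrC; exact: IM.
have fxR : fractional_ideal (scale_ideal x R).
  have [[R0 RD RM] _] := base_ring_integral (A := A).
  split; [split| |].
  - by exists 0; rewrite ?mulr0.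
  - move=> _ _ [y Ry <-] [z Rz <-].
    by exists (y + z); [exact: RD|rewrite mulrDr].
  - by move=> r _ [y Ry <-]; exists (tofrac r * y); [exact: RM|rewrite mulrCA].
  - by exists x.
  - by exists d => // y /xRI; exact: dI.
apply: (star_mono star_op fxR fI xRI).
by rewrite (star_scale star_op (base_ring_fractional (A := A)) x0)
           (star_base star_op).
Qed.

Lemma star_integral I :
  fractional_ideal I -> integral_ideal I -> integral_ideal (star I).
Proof.
move=> fI [_ IR]; have [subI _ _] := star_fractional star_op fI.
split=> //; rewrite -(star_base star_op).
exact: (star_mono star_op fI (base_ring_fractional (A := A)) IR).
Qed.

Lemma star_is_star_ideal I : fractional_ideal I -> star_ideal star (star I).
Proof.
move=> fI; split; first exact: (star_fractional star_op).
exact: (star_idem star_op fI).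
Qed.

Lemma proper1N I : proper_integral_ideal I -> ~ I 1.
Proof. by move=> [iI IR] I1; apply: IR; exact: integral_ideal_full. Qed.

Lemma star_least I N :
  fractional_ideal I -> star_ideal star N -> I `<=` N -> star I `<=` N.
Proof. by move=> fI [fN NE] IN; rewrite -NE; exact: (star_mono star_op fI fN IN). Qed.

Lemma star_elem I x : fractional_ideal I -> star I x ->
  exists s, [/\ [set` s] `<=` I, fractional_ideal (seq_span s) &
                star (seq_span s) x].
Proof.
move=> fI; rewrite (star_ft fI) => -[J [JI fJ /fg_seq_span[s JE]] Jx].
by exists s; rewrite -JE; split=> // y /seq_span_gen; rewrite -JE; exact: JI.
Qed.

(** Zorn's lemma. Finite type makes the union [U] of a chain a star-ideal: an element of [star U]
    already lies in the star of a finitely generated ideal, whose generators lie in a single member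
    of the chain. *)
Lemma star_maximal_exists I :
  proper_integral_ideal I -> star_ideal star I ->
  exists2 M, star_maximal star M & I `<=` M.
Proof.
move=> pI sI.
have [[subI _] _] := pI; have [[_ [x0 Ix0 x0N0] _] _] := sI.
pose Q X := [/\ proper_integral_ideal X, star_ideal star X & I `<=` X].
have [|M [PM Mmax]] := @Zorn_bigcup _ (fun X => X = set0 \/ Q X).
  move=> F FP totF; have [[X FX QX]|noQ] := pselect (exists2 X, F X & Q X); last first.
    left; apply/seteqP; split=> // x [X FX Xx].
    by have [X0|QX] := FP X FX; [move: Xx; rewrite X0|apply: noQ; exists X].
  right; set U := \bigcup_(X in F) X.
  have XU Y : F Y -> Y `<=` U by move=> FY y Yy; exists Y.
  have subseqU s : [set` s] `<=` U -> exists2 Y, (F Y /\ Q Y) & [set` s] `<=` Y.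
    move=> sU; have [|Y FY sY] := @chain_seq_sub _ F X (x0 :: s) FX totF.
      move=> y /=; rewrite inE => /predU1P[->|/sU//].
      by apply: XU FX _ _; have [_ _] := QX; apply.
    exists Y; last by move=> y ys; apply: sY; rewrite /= inE (ys : y \in s) orbT.
    split=> //; have [Y0|//] := FP Y FY.
    by have := sY x0; rewrite /= mem_head Y0 => /(_ isT).
  have iU : integral_ideal U.
    split; last first.
      move=> y Uy; have [|Y [_ [[[_ YR] _] _ _]] yY] := subseqU [:: y].
        by move=> z /=; rewrite inE => /eqP->.
      by apply: YR; apply: yY; rewrite /= mem_head.
    split.
    - have [[[[X0 _ _] _] _] _ _] := QX; exact: XU FX _ X0.
    - move=> y z Uy Uz; have [|Y [FY [[[[_ YD _] _] _] _ _]] yzY] := subseqU [:: y; z].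
        by move=> w /=; rewrite !inE => /orP[]/eqP->.
      by apply: XU FY _ _; apply: YD; apply: yzY; rewrite /= !inE eqxx ?orbT.
    - move=> r y [Y FY Yy]; have [Y0|[[[[_ _ YM] _] _] _ _]] := FP Y FY.
        by move: Yy; rewrite Y0.
      by apply: XU FY _ _; exact: YM.
  have IU : I `<=` U by move=> y Iy; apply: XU FX _ _; have [_ _] := QX; apply.
  have fU : fractional_ideal U by apply: integral_fractional iU (IU _ Ix0) x0N0.
  split=> //.
    split=> // UR; have U1 : U 1 by rewrite UR; exists 1 => //; rewrite tofrac1.
    have [|Y [_ [pY _ _]] Y1] := subseqU [:: 1].
      by move=> z /=; rewrite inE => /eqP->.
    by apply: (proper1N pY); apply: Y1; rewrite /= mem_head.
  split=> //; apply/seteqP; split; last exact: sub_star.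
  move=> x /(star_elem fU)[s [sU fs sx]].
  have [Y [FY [[[subY _] _] sY _]] sYs] := subseqU s sU.
  by apply: XU FY _ _; apply: star_least fs sY _ _ sx; exact: seq_span_sub.
(* A maximal element cannot be empty, since [I] itself would be strictly larger. *)
have [M0|[pM sM IM]] := PM.
  have QI : Q I by split.
  by case: (Mmax I); [rewrite M0; split=> // /(_ _ Ix0)|right].
exists M => //; split=> // J pJ sJ MJ; apply: contrapT => JM.
apply: (Mmax J); last by right; split=> //; exact: subset_trans MJ.
by split=> // JsM; apply: JM; apply/seteqP.
Qed.

Lemma star_maximal_sub_eq {M N} :
  star_maximal star M -> star_maximal star N -> M `<=` N -> M = N.
Proof. by move=> [_ _ Mmax] [pN sN _] MN; rewrite (Mmax N). Qed.

Lemma star_eq_base I : fractional_ideal I -> integral_ideal I ->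
  (forall N, star_maximal star N -> ~ I `<=` N) -> star I = R.
Proof.
move=> fI iI noN; apply: contrapT => IR.
have [|N mN IN] := @star_maximal_exists (star I) _ (star_is_star_ideal fI).
  by split=> //; exact: star_integral.
by apply: (noN N mN); apply: subset_trans IN; exact: sub_star.
Qed.

Lemma star_maximal_submodule M : star_maximal star M -> submodule M.
Proof. by case=> [[[]]]. Qed.

(** No star-maximal ideal contains [M1 + M2], so its star contains 1. By finite type finitely many
    elements of the sum suffice for this, and splitting them into summands gives [u] and [v]. *)
Lemma star_maximal_separate M1 M2 :
  star_maximal star M1 -> star_maximal star M2 -> M1 <> M2 ->
  exists u v, [/\ [set` u] `<=` M1, [set` v] `<=` M2 &
    forall N, star_maximal star N -> ~ [set` u ++ v] `<=` N].
Proof.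
move=> mM1 mM2 M12.
have [[iM1 _] [[subM1 [x M1x x0] _] _] _] := mM1.
have [[iM2 _] [[subM2 _ _] _] _] := mM2.
have iS := add_ideal_integral iM1 iM2.
have fS := integral_fractional iS (add_idealL subM2 M1x) x0.
have S1 : star (add_ideal M1 M2) 1.
  rewrite star_eq_base//; first by exists 1 => //; rewrite tofrac1.
  move=> N mN SN; apply: M12.
  rewrite (star_maximal_sub_eq mM1 mN); last exact: subset_trans (add_idealL subM2) SN.
  by rewrite (star_maximal_sub_eq mM2 mN)//; exact: subset_trans (add_idealR subM1) SN.
have [s [sS fs s1]] := star_elem fS S1.
have [u [v [uM vM uvs]]] := add_ideal_seq sS.
exists u, v; split=> // N mN uvN; have [pN sN _] := mN.
apply: (proper1N pN); apply: star_least fs sN _ _ s1.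
have subN := star_maximal_submodule mN.
by apply: seq_span_sub => //; exact: uvs.
Qed.

Lemma seq_span_integral s M :
  star_maximal star M -> [set` s] `<=` M -> integral_ideal (seq_span s).
Proof.
move=> mM sM; split; first exact: seq_span_submodule.
have [[[subM MR] _] _ _] := mM.
by apply: subset_trans MR; exact: seq_span_sub.
Qed.

(** Reduces questions about star-finite star-ideals below [M] to their finitely many generators. *)
Lemma star_seq_span_sub s M : fractional_ideal (seq_span s) ->
  star_maximal star M -> (star (seq_span s) `<=` M) <-> ([set` s] `<=` M).
Proof.
move=> fs mM; split=> [sM|sM].
  apply: subset_trans sM; apply: subset_trans (sub_star fs).
  exact: seq_span_gen.
have [_ stM _] := mM; apply: star_least fs stM _; apply: seq_span_sub sM.
exact: star_maximal_submodule.
Qed.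

(** * From finite comaximal collections to finitely many star-maximal ideals *)

Section FiniteCollections.
Variables (a : A) (a0 : a != 0).
Hypothesis finF : forall F : set (set K),
  star_comaximal_collection star a F ->
  (forall I, F I ->
     [/\ proper_integral_ideal I, star_finite star I & star_ideal star I]) ->
  finite_set F.

(** The ideals [star (seq_span (s i))] form a collection covered by [finF]. That no star-maximal
    ideal contains two of the sequences gives both comaximality and injectivity in [i]. *)
Lemma finite_separated {T : Type} (D : set T) (s : T -> seq K) :
  (forall i, D i -> tofrac a \in s i) ->
  (forall i, D i -> exists2 M, star_maximal star M & [set` s i] `<=` M) ->
  (forall i j M, D i -> D j -> star_maximal star M ->
     [set` s i] `<=` M -> [set` s j] `<=` M -> i = j) ->
  finite_set D.
Proof.
move=> as_ Ms sep.
have fa0 : tofrac a != 0 :> K by rewrite tofrac_eq0.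
have aspan i : D i -> seq_span (s i) (tofrac a).
  by move=> Di; apply: seq_span_gen; exact: as_.
have ispan i : D i -> integral_ideal (seq_span (s i)).
  by move=> Di; have [M mM sM] := Ms i Di; exact: seq_span_integral mM sM.
have fspan i : D i -> fractional_ideal (seq_span (s i)).
  move=> Di; exact: integral_fractional (ispan i Di) (aspan i Di) fa0.
have ist i : D i -> integral_ideal (star (seq_span (s i))).
  by move=> Di; exact: star_integral (fspan i Di) (ispan i Di).
have ast i : D i -> star (seq_span (s i)) (tofrac a).
  by move=> Di; apply: (sub_star (fspan i Di)); exact: aspan.
apply: (@finite_set_inj _ _ (fun i => star (seq_span (s i)))).
  (* Equal stars lie in the same star-maximal ideals, so [M] contains both sequences. *)
  move=> i j Di Dj ij; have [M mM sM] := Ms i Di.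
  apply: (sep i j M) => //.
  apply/(star_seq_span_sub (fspan j Dj) mM); rewrite -ij.
  exact/(star_seq_span_sub (fspan i Di) mM).
apply: finF.
  split=> [_ [i Di <-]|_ [i Di <-]|_ _ [i Di <-] [j Dj <-] ij]; [exact: ist|exact: ast|].
  have [subi _] := ist i Di; have [subj _] := ist j Dj.
  apply: star_eq_base; last first.
  - move=> N mN ijN; apply: ij; congr (star (seq_span (s _))); apply: (sep i j N) => //.
      apply/(star_seq_span_sub (fspan i Di) mN).
      by apply: subset_trans ijN; exact: add_idealL.
    apply/(star_seq_span_sub (fspan j Dj) mN).
    by apply: subset_trans ijN; exact: add_idealR.
  - by apply: add_ideal_integral; exact: ist.
  - apply: (@integral_fractional _ _ (tofrac a)) fa0.
      by apply: add_ideal_integral; exact: ist.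
    by apply: add_idealL => //; exact: ast.
move=> _ [i Di <-]; split.
- split; first exact: ist.
  move=> iR; have [M mM sM] := Ms i Di; have [pM _ _] := mM.
  apply: (proper1N pM); have /(star_seq_span_sub (fspan i Di) mM) := sM.
  by apply; rewrite iR; exists 1 => //; rewrite tofrac1.
- have [fst stE] := star_is_star_ideal (fspan i Di).
  split=> //; exists (seq_span (s i)).
  by split; [exact: fspan|exact: seq_span_fg|rewrite stE].
- exact: star_is_star_ideal (fspan i Di).
Qed.

Let isolating M t := tofrac a \in t /\
  forall N, star_maximal star N -> ([set` t] `<=` N <-> N = M).

Let isolated := [set M | star_maximal star M /\ exists t, isolating M t].

(** A star-maximal ideal containing two isolating sequences equals both of the ideals they isolate,
    so [finite_separated] applies. *)
Lemma finite_isolated : finite_set isolated.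
Proof.
have /choice[t tP] M : exists t, isolated M -> isolating M t.
  have [[mM [t tM]]|] := pselect (isolated M); first by exists t.
  by exists [::].
apply: (finite_separated (s := t)) => [M /tP[]//|M isoM|M N P isoM isoN mP].
  have [mM _] := isoM; exists M => //; have [_ tM] := tP _ isoM; exact/tM.
have [_ tM] := tP _ isoM; have [_ tN] := tP _ isoN.
by move=> /(tM _ mP)<- /(tN _ mP)<-.
Qed.

(** Otherwise every finite extension of [s] inside a star-maximal ideal lies in at least two of them
    and can be split. Keeping one half and splitting the other forever yields infinitely many
    separated sequences. *)
Lemma isolated_above s M :
  tofrac a \in s -> star_maximal star M -> [set` s] `<=` M ->
  exists2 N, isolated N & [set` s] `<=` N.
Proof.
move=> sa mM sM; apply: contrapT => noiso.
pose Q t := [/\ [set` s] `<=` [set` t] &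
                exists2 N, star_maximal star N & [set` t] `<=` N].
have split_seq (t : {t | Q t}) : exists uv : {t | Q t} * {t | Q t},
    [/\ [set` sval t] `<=` [set` sval uv.1],
        [set` sval t] `<=` [set` sval uv.2] &
        forall N, star_maximal star N -> [set` sval uv.1] `<=` N ->
          ~ [set` sval uv.2] `<=` N].
  case: t => t [st [M1 mM1 tM1]] /=.
  (* Were [M1] the only star-maximal ideal containing [t], then [t] would isolate it. *)
  have [M2 [mM2 tM2 M12]] :
      exists M2, [/\ star_maximal star M2, [set` t] `<=` M2 & M1 <> M2].
    apply: contrapT => noM2; apply: noiso; exists M1; last exact: subset_trans tM1.
    split=> //; exists t; split; first exact: st.
    move=> N mN; split=> [tN|->//]; apply: contrapT => NM1.
    by apply: noM2; exists N; split=> // M1N; exact: NM1.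
  have [u [v [uM vM uv]]] := star_maximal_separate mM1 mM2 M12.
  have catl (w : seq K) : [set` t] `<=` [set` t ++ w].
    by move=> x /= xt; rewrite mem_cat xt.
  have catQ (w : seq K) N : star_maximal star N -> [set` t] `<=` N ->
      [set` w] `<=` N -> Q (t ++ w).
    move=> mN tN wN; split; first exact: subset_trans (catl w).
    by exists N => // x /=; rewrite mem_cat => /orP[/tN|/wN].
  exists (exist _ _ (catQ _ _ mM1 tM1 uM), exist _ _ (catQ _ _ mM2 tM2 vM)).
  split; [exact: catl|exact: catl|move=> N mN /= tuN tvN].
  apply: (uv N mN) => x /=; rewrite mem_cat => /orP[xu|xv].
    by apply: tuN; rewrite /= mem_cat xu orbT.
  by apply: tvN; rewrite /= mem_cat xv orbT.
have [f fP] := choice split_seq.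
have Qs : Q s by split=> //; exists M.
(* [z n] is the half that is split again, and [w n] the half set aside at stage [n]. *)
pose z n := iter n (fun t : {t | Q t} => (f t).1) (exist _ s Qs).
pose w n := sval (f (z n)).2.
have zle m n : (m <= n)%N -> [set` sval (z m)] `<=` [set` sval (z n)].
  elim: n => [|n IHn]; first by rewrite leqn0 => /eqP->.
  rewrite leq_eqVlt => /predU1P[->//|]; rewrite ltnS => /IHn mn.
  by apply: subset_trans mn _; have [] := fP (z n).
(* For [m < n], [w n] extends [z n] and hence [z m.+1], the half of [z m] opposite to [w m]. *)
have sep m n N : (m < n)%N -> star_maximal star N ->
    [set` w m] `<=` N -> ~ [set` w n] `<=` N.
  move=> mn mN wmN wnN; have [_ _ /(_ N mN)] := fP (z m); apply=> //.
  apply: subset_trans wnN; apply: (subset_trans (zle m.+1 n mn)).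
  by have [] := fP (z n).
apply: infinite_nat; apply: (@finite_separated nat setT w) => [n _|n _|m n N _ _ mN wm wn].
- by have [sw _] := svalP (f (z n)).2; exact: sw.
- by have [] := svalP (f (z n)).2.
- by have [mn|nm|//] := ltngtP m n; [case: (sep m n N mn)|case: (sep n m N nm)].
Qed.

Lemma finite_star_maximal : finite_set [set M | star_maximal star M /\ M (tofrac a)].
Proof.
apply: sub_finite_set finite_isolated => M [mM Ma]; apply: contrapT => niso.
(* If [M] is not isolated, maximality gives an element of [M] outside each isolated [N]; 0 is a
   default value for the other [N]. *)
have /choice[x xP] N : exists x, isolated N -> M x /\ ~ N x.
  have [isoN|] := pselect (isolated N); last by exists 0.
  have /existsNP[x /not_implyP[Mx Nx]] : ~ M `<=` N.
    have [mN _] := isoN.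
    by move=> /(star_maximal_sub_eq mM mN) MN; apply: niso; rewrite MN.
  by exists x.
have /finite_seqP[l lE] := finite_isolated.
have lP N : N \in l = isolated N :> Prop by rewrite lE.
(* The sequence lies in [M], so an isolated [N] contains all of it, in particular [x N], a
   contradiction. *)
have [||N isoN aN] := @isolated_above (tofrac a :: [seq x N | N <- l]) M _ mM.
- by rewrite mem_head.
- move=> y /=; rewrite inE => /predU1P[->//|/mapP[N]].
  by rewrite lP => /xP[Mx _] ->.
- have [_] := xP N isoN; apply; apply: aN => /=.
  by rewrite inE map_f ?orbT// lP.
Qed.

End FiniteCollections.

(** * From the star-finite character to finite comaximal collections *)

Lemma finite_comaximal_collection (a : A) (F : set (set K)) :
  star_finite_character star -> a != 0 ->
  star_comaximal_collection star a F ->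
  (forall I, F I -> proper_integral_ideal I /\ star_ideal star I) ->
  finite_set F.
Proof.
move=> finM a0 [iF aF coF] FP.
have /choice[m mP] I : exists M, F I -> star_maximal star M /\ I `<=` M.
  have [FI|] := pselect (F I); last by exists set0.
  have [pI sI] := FP I FI; have [M mM IM] := star_maximal_exists pI sI.
  by exists M.
(* The chosen ideals [m I] all contain [a], so there are finitely many. Distinct members cannot
   share one, since it would contain the star of their sum, which is all of [A]. *)
apply: (@finite_set_inj _ _ m); last first.
  apply: sub_finite_set (finM a a0) => _ [I FI <-].
  by have [mI ImI] := mP I FI; split=> //; apply: ImI; exact: aF.
move=> I J FI FJ mIJ; apply: contrapT => IJ.
have [mM IM] := mP I FI; have [_] := mP J FJ; rewrite -mIJ => JM.
have [pM sM _] := mM; apply: (proper1N pM).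
have fIJ : fractional_ideal (add_ideal I J).
  apply: (@integral_fractional _ _ (tofrac a)); last by rewrite tofrac_eq0.
    by apply: add_ideal_integral; exact: iF.
  by apply: add_idealL (aF I FI); have [] := iF J FJ.
have /(star_least fIJ sM) : add_ideal I J `<=` m I.
  exact: add_ideal_sub (star_maximal_submodule mM) IM JM.
by rewrite coF//; apply; exists 1 => //; rewrite tofrac1.
Qed.

End StarMaximal.

Theorem proposition1p6 (A : idomainType)
    (star : set {fraction A} -> set {fraction A})
    (star_op : star_operation star) (star_ft : finite_type star) :
  star_finite_character star <->
  (forall a : A, a != 0 ->
     forall F : set (set {fraction A}),
       star_comaximal_collection star a F ->
       (forall I, F I ->
          [/\ proper_integral_ideal I, star_finite star I & star_ideal star I]) ->
       finite_set F).
Proof.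
split=> [finM a a0 F coF FP|finF a a0].
  by apply: (finite_comaximal_collection star_op star_ft finM a0 coF) => I /FP[].
exact: (finite_star_maximal star_op star_ft a0 (finF a a0)).
Qed.
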